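(* Let $\Omega$ be a topological space. Suppose that $\mathcal{K}\subset\mathcal{C}(\Omega)$ is a convex set that is stable under maxima, contains the constant functions, and satisfies $\mathcal{K}+c\subset\mathcal{K}$ for every constant $c\in\mathbb{R}$. Let $f\in\mathcal{K}$. Then the tangent cone to $\mathcal{K}$ at $f$, i.e. the set $$\mathcal{F}=\{\lambda(g-f)\mid g\in\mathcal{K},\ \lambda\geq 0\},$$ is a convex cone, is stable under maxima, and contains the constant functions.
   Context: $\mathcal{C}(\Omega)$ denotes the Banach space of bounded continuous real-valued functions on a topological space $\Omega$. A subset $\mathcal{K}$ of $\mathcal{C}(\Omega)$ is stable under maxima if the pointwise maximum $f\vee g$ of any two functions $f,g\in\mathcal{K}$ belongs to $\mathcal{K}$. *)

(* Defs.v *)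
From HB Require Import structures.
From mathcomp Require Import all_boot all_order all_algebra.
From mathcomp Require Import all_classical all_reals all_analysis.

Set Implicit Arguments.
Unset Strict Implicit.
Unset Printing Implicit Defensive.

Import Order.TTheory GRing.Theory Num.Theory.
Import numFieldNormedType.Exports.

Local Open Scope classical_set_scope.
Local Open Scope ring_scope.

Section BoundedContinuous.
Context (Omega : topologicalType) (R : realType).

Definition bounded_continuous : {pred Omega -> R} :=
  [pred f : Omega -> R | `[< continuous f /\ bounded_fun f >]].

Lemma bounded_continuousP (f : Omega -> R) :
  reflect (continuous f /\ exists M, forall x, `|f x| <= M)
          (f \in bounded_continuous).
Proof.
apply: (iffP (asboolP _)) => [[fc fb]|[fc [M fM]]].
  by split=> //; have [M _ fM] := ex_strict_bound_gt0 fb;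
    exists M => x; apply/ltW/fM.
split=> //; exists M; split; first exact: num_real.
by move=> N MN x _; apply: le_trans (fM x) (ltW MN).
Qed.

Lemma bounded_continuous_submod : submod_closed bounded_continuous.
Proof.
split=> [|a f g /bounded_continuousP[fc [M fM]]
             /bounded_continuousP[gc [N gN]]]; apply/bounded_continuousP.
  split=> [x|]; first exact: cvg_cst.
  by exists 0 => x; rewrite normr0.
split=> [x|]; first by apply: cvgD; [apply: cvgZl_tmp; exact: fc|exact: gc].
exists (`|a| * M + N) => x; rewrite (le_trans (ler_normD _ _))// lerD//.
by rewrite normrM ler_wpM2l.
Qed.

HB.instance Definition _ := GRing.isSubmodClosed.Build R (Omega -> R)
  bounded_continuous bounded_continuous_submod.

Record bcfun := BCFun {
  bcfun_val :> Omega -> R;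
  bcfunP : bcfun_val \in bounded_continuous }.

HB.instance Definition _ := [isSub for bcfun_val].
HB.instance Definition _ := [Choice of bcfun by <:].
HB.instance Definition _ := [SubChoice_isSubLmodule of bcfun by <:].

Lemma bounded_continuous_cst (c : R) : cst c \in bounded_continuous.
Proof.
by apply/bounded_continuousP; split; [move=> x; exact: cvg_cst|exists `|c|].
Qed.

Definition bccst (c : R) : bcfun := BCFun (bounded_continuous_cst c).

Lemma bounded_continuous_max (f g : bcfun) :
  (f : Omega -> R) \max g \in bounded_continuous.
Proof.
have /bounded_continuousP[fc [M fM]] := bcfunP f.
have /bounded_continuousP[gc [N gN]] := bcfunP g.
apply/bounded_continuousP; split=> [x|].
  exact: (continuous_max (fc x) (gc x)).
exists (Num.max M N) => x /=; rewrite le_max.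
by case: (leP (f x) (g x)) => _; rewrite ?fM ?gN ?orbT.
Qed.

Definition bcmax (f g : bcfun) : bcfun := BCFun (bounded_continuous_max f g).

Definition stable_max (A : set bcfun) := forall f g, A f -> A g -> A (bcmax f g).

End BoundedContinuous.

Section Cones.
Context (R : realType) (V : lmodType R).

Definition convex_cone (A : set V) :=
  convex_set A /\ forall (l : R) v, 0 <= l -> A v -> A (l *: v).

Definition tangent_cone (A : set V) (v : V) : set V :=
  [set l *: (w - v) | l in [set l : R | 0 <= l] & w in A].

End Cones.

(* Main.v *)
(* Since [f] lies in the convex set [K], the dilation [g |-> f + t (g - f)] maps
   [K] into itself for [0 <= t <= 1], so any two elements of the tangent cone
   can be written [l (g - f)] and [l (h - f)] with the same scale [l > 0].
   Convex combinations and maxima then pass through [l (_ - f)]. *)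
Require Import Defs.
From mathcomp Require Import all_boot all_order all_algebra.
From mathcomp Require Import all_classical all_reals all_analysis.
Set Implicit Arguments.
Unset Strict Implicit.
Unset Printing Implicit Defensive.

Import Order.TTheory GRing.Theory Num.Theory.
Import numFieldNormedType.Exports.
Local Open Scope classical_set_scope.
Local Open Scope ring_scope.

(** Replaces the bundled weights in [[0, 1]] and boolean membership of [convex_set] by a plain
    scalar with two inequalities. *)
Lemma convex_setE (R : numDomainType) (V : lmodType R) (A : set V) :
  convex_set A <->
  forall (x y : V) (t : R), 0 <= t -> t <= 1 -> A x -> A y ->
    A (t *: x + (1 - t) *: y).
Proof.
split=> [cA x y t t0 t1 Ax Ay|cA x y t].
  by have /set_mem := cA x y (Itv01 t0 t1) (mem_set Ax) (mem_set Ay).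
move=> /set_mem Ax /set_mem Ay; apply/mem_set.
exact: (cA x y t%:num (ge0 t) (le1 t)).
Qed.

Section TangentCone.
Context (R : realType) (V : lmodType R) (A : set V) (v : V).
Hypotheses (cA : convex_set A) (Av : A v).

Lemma tangent_cone_rescale (l m : R) (w : V) :
  0 <= l -> l <= m -> 0 < m -> A w ->
  exists2 w', A w' & l *: (w - v) = m *: (w' - v).
Proof.
move=> l0 lm m0 Aw.
(* This is [v + (l / m) *: (w - v)], on the segment from [v] to [w] because [l <= m]. *)
exists ((l / m) *: w + (1 - l / m) *: v).
  move/convex_setE: cA; apply=> //; first by rewrite divr_ge0// ltW.
  by rewrite ler_pdivrMr// mul1r.
rewrite scalerBl scale1r addrCA addrAC subrr add0r -scalerBr scalerA.
by rewrite mulrC divfK// gt_eqF.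
Qed.

Lemma tangent_cone_common_scale (x y : V) :
  tangent_cone A v x -> tangent_cone A v y ->
  exists m w z, [/\ 0 < m, A w, A z, x = m *: (w - v) & y = m *: (z - v)].
Proof.
move=> [l /= l0 [w Aw <-]] [k /= k0 [z Az <-]].
(* The summand [1] keeps the common scale positive even when [l = k = 0]. *)
have m0 : 0 < l + k + 1 by rewrite ltr_wpDl// addr_ge0.
have lm : l <= l + k + 1 by rewrite -addrA lerDl addr_ge0.
have km : k <= l + k + 1 by rewrite addrAC lerDr addr_ge0.
have [w' Aw' ->] := tangent_cone_rescale l0 lm m0 Aw.
have [z' Az' ->] := tangent_cone_rescale k0 km m0 Az.
by exists (l + k + 1), w', z'.
Qed.

Lemma convex_cone_tangent_cone : convex_cone (tangent_cone A v).
Proof.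
split=> [|l _ l0 [k /= k0 [w Aw <-]]]; last first.
  by exists (l * k); rewrite /= ?mulr_ge0//; exists w; rewrite ?scalerA.
apply/convex_setE => x y t t0 t1 Tx Ty.
have [m [w [z [m0 Aw Az -> ->]]]] := tangent_cone_common_scale Tx Ty.
exists m; first exact: ltW.
exists (t *: w + (1 - t) *: z); first by move/convex_setE: cA; apply.
rewrite !scalerA ![_ * m]mulrC -!scalerA -scalerDr; congr (_ *: _).
(* The weights sum to 1, so the two subtracted multiples of [v] add up to [v]. *)
by rewrite !scalerBr addrACA -opprD -scalerDl subrKC scale1r.
Qed.

End TangentCone.

(** Pointwise, both translation and multiplication by a nonnegative scalar are nondecreasing, so
    they commute with [Num.max]. *)
Lemma bcmax_scaleB (R : realType) (Omega : topologicalType)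
    (l : R) (g h f : bcfun Omega R) :
  0 <= l -> bcmax (l *: (g - f)) (l *: (h - f)) = l *: (bcmax g h - f).
Proof.
move=> l0; apply/val_inj/funext => x /=.
by rewrite -[RHS]/(l * (Num.max (g x) (h x) - f x)) addr_maxl maxr_pMr.
Qed.

Theorem proposition2p3 (R : realType) (Omega : topologicalType)
    (K : set (bcfun Omega R)) (f : bcfun Omega R) :
  convex_set K ->
  stable_max K ->
  (forall c : R, K (bccst Omega c)) ->
  (forall c : R, [set g + bccst Omega c | g in K] `<=` K) ->
  K f ->
  [/\ convex_cone (tangent_cone K f),
      stable_max (tangent_cone K f) &
      forall c : R, tangent_cone K f (bccst Omega c)].
Proof.
move=> cK maxK _ KD Kf; split; first exact: convex_cone_tangent_cone.
  move=> x y Tx Ty.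
  have [m [g [h [m0 Kg Kh -> ->]]]] := tangent_cone_common_scale cK Kf Tx Ty.
  exists m; first exact: ltW.
  by exists (bcmax g h); [exact: maxK|rewrite bcmax_scaleB// ltW].
(* A constant is the direction from [f] to its translate [f + c], which stays in [K]; scale 1
   suffices. *)
move=> c; exists 1; first exact: ler01.
exists (f + bccst Omega c); first by apply: (KD c); exists f.
by rewrite scale1r addrC addKr.
Qed.
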